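(* Let $X$ be a locally compact first countable Hausdorff space, let $x=(x_n)_{n\in\mathbf{N}}$ be a sequence taking values in $X$, and let $\mathcal{I}_\varphi$ be an analytic P-ideal on $\mathbf{N}$. Then each isolated $\mathcal{I}_\varphi$-cluster point of $x$ (that is, each isolated point of the set $\Gamma_x(\mathcal{I}_\varphi)$) is also an $\mathcal{I}_\varphi$-limit point of $x$ (that is, belongs to $\Lambda_x(\mathcal{I}_\varphi)$).
   Context: $\mathbf{N}$ denotes the positive integers. An ideal $\mathcal{I}$ on $\mathbf{N}$ is a collection of subsets of $\mathbf{N}$ closed under finite unions and subsets; it is assumed to contain the family $\mathrm{Fin}$ of finite subsets of $\mathbf{N}$ and to be different from $\mathcal{P}(\mathbf{N})$. A map $\varphi:\mathcal{P}(\mathbf{N})\to[0,\infty]$ is a lower semicontinuous submeasure if $\varphi(\emptyset)=0$; $\varphi(A)\le\varphi(B)$ whenever $A\subseteq B$; $\varphi(A\cup B)\le\varphi(A)+\varphi(B)$ for all $A,B$; and $\varphi(A)=\lim_n\varphi(A\cap\{1,\ldots,n\})$ for all $A$. Put $\|A\|_\varphi:=\lim_n\varphi(A\setminus\{1,\ldots,n\})$. By a theorem of Solecki, an ideal $\mathcal{I}$ on $\mathbf{N}$ is an analytic P-ideal if and only if $\mathcal{I}=\mathcal{I}_\varphi:=\{A\subseteq\mathbf{N}:\|A\|_\varphi=0\}$ for some lower semicontinuous submeasure $\varphi$ with $\varphi(\mathbf{N})<\infty$; an analytic P-ideal is always written as $\mathcal{I}_\varphi$ for such a fixed $\varphi$.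 $\Lambda_x(\mathcal{I})$ (the $\mathcal{I}$-limit points of $x$) is the set of all $\ell\in X$ such that $\lim_{k\to\infty}x_{n_k}=\ell$ for some subsequence $(x_{n_k})$ with $\{n_k:k\in\mathbf{N}\}\notin\mathcal{I}$. $\Gamma_x(\mathcal{I})$ (the $\mathcal{I}$-cluster points of $x$) is the set of all $\ell\in X$ such that $\{n:x_n\in U\}\notin\mathcal{I}$ for every neighborhood $U$ of $\ell$. A topological space is locally compact if every point has a neighborhood whose closure is compact. *)

(* Defs.v *)
From HB Require Import structures.
From mathcomp Require Import all_boot all_order all_algebra.
From mathcomp Require Import all_classical all_reals all_analysis.

Set Implicit Arguments.
Unset Strict Implicit.
Unset Printing Implicit Defensive.

Import Order.TTheory GRing.Theory Num.Theory.

Local Open Scope classical_set_scope.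
Local Open Scope ring_scope.
Local Open Scope ereal_scope.

(* Positive integers are represented by [nat], with i standing for i + 1;
   thus [`I_n], the set of all i < n, stands for {1, ..., n}. *)

Record ideal (I : set (set nat)) : Prop := Ideal {
  ideal_sub : forall A B : set nat, A `<=` B -> I B -> I A;
  ideal_setU : forall A B : set nat, I A -> I B -> I (A `|` B);
  ideal_finite : forall A : set nat, finite_set A -> I A;
  ideal_proper : I <> setT
}.

Record lsc_submeasure (R : realType) (phi : set nat -> \bar R) : Prop :=
  LscSubmeasure {
  lsc_submeasure_ge0 : forall A, 0 <= phi A;
  lsc_submeasure0 : phi set0 = 0;
  lsc_submeasure_le : forall A B : set nat, A `<=` B -> phi A <= phi B;
  lsc_submeasureU : forall A B : set nat, phi (A `|` B) <= phi A + phi B;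
  lsc_submeasure_cvg : forall A : set nat,
    phi (A `&` `I_n) @[n --> \oo] --> phi A
}.

(* For a submeasure the sequence is nonincreasing, so the limit exists. *)
Definition exh_norm (R : realType) (phi : set nat -> \bar R) (A : set nat)
  : \bar R := limn (fun n : nat => phi (A `\` `I_n)).

Definition exh_ideal (R : realType) (phi : set nat -> \bar R) : set (set nat) :=
  [set A | exh_norm phi A = 0].

(* By Solecki's theorem, the analytic P-ideals are exactly the ideals of the
   form [exh_ideal phi] with [phi] as below; following the usual convention,
   such an ideal is always given together with [phi]. *)
Record analytic_Pideal_of (R : realType) (phi : set nat -> \bar R) : Prop :=
  AnalyticPIdealOf {
  analytic_Pideal_lsc : lsc_submeasure phi;
  analytic_Pideal_lty : phi setT < +oo;
  analytic_Pideal_ideal : ideal (exh_ideal phi)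
}.

Definition ideal_limit_points (X : topologicalType) (x : nat -> X)
    (I : set (set nat)) : set X :=
  [set l | exists nk : nat -> nat,
    [/\ increasing_seq nk, x (nk k) @[k --> \oo] --> l & ~ I (range nk)]].

Definition ideal_cluster_points (X : topologicalType) (x : nat -> X)
    (I : set (set nat)) : set X :=
  [set l | forall U : set X, nbhs l U -> ~ I (x @^-1` U)].

Definition first_countable (X : topologicalType) : Prop :=
  forall p : X, exists B : set (set X),
    [/\ countable B, B `<=` nbhs p &
        forall U : set X, nbhs p U -> exists2 V : set X, B V & V `<=` U].

(* Main.v *)
(* Let K be a compact neighborhood of l containing no other cluster point, and
   (U n) a decreasing neighborhood base at l.  By compactness, x visits
   K `\` (interior of U n) only along a set of the ideal, so the norms of the sets
   x @^-1` (U n) stay bounded below.  Lower semicontinuity then extracts from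
   each of these sets a finite block far away with submeasure bounded below; the
   union of the blocks is not in the ideal, and x tends to l along it. *)

Require Import Defs.
From HB Require Import structures.
From mathcomp Require Import all_boot all_order all_algebra.
From mathcomp Require Import all_classical all_reals all_analysis.

Set Implicit Arguments.
Unset Strict Implicit.
Unset Printing Implicit Defensive.

Import Order.TTheory GRing.Theory Num.Theory.

Local Open Scope classical_set_scope.
Local Open Scope ring_scope.
Local Open Scope ereal_scope.

Section submeasure.
Variables (R : realType) (phi : set nat -> \bar R).
Hypothesis phi_lsc : lsc_submeasure phi.

Lemma exh_norm_inf (A : set nat) :
  exh_norm phi A = ereal_inf (range (fun n => phi (A `\` `I_n))).
Proof.
apply/cvg_lim => //; apply: ereal_nonincreasing_cvgn => m n mn.
apply: lsc_submeasure_le => // i [Ai /= /negP]; rewrite -leqNgt => ni.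
by split=> //; apply/negP; rewrite -leqNgt (leq_trans mn).
Qed.

Lemma exh_idealP (A : set nat) : exh_ideal phi A <->
  forall r : R, (0 < r)%R -> exists m, phi (A `\` `I_m) < r%:E.
Proof.
rewrite /exh_ideal /= exh_norm_inf; split=> [inf0 r r0|small].
  have : ereal_inf (range (fun n => phi (A `\` `I_n))) < r%:E.
    by rewrite inf0 lte_fin.
  by move=> /ereal_inf_lt[_ [m _ <-]]; exists m.
apply/eqP; rewrite eq_le; apply/andP; split.
  apply/lee_addgt0Pr => r /small[m /ltW phim]; rewrite add0e.
  by apply: le_trans phim; apply: ereal_inf_lbound; exists m.
by apply: le_ereal_inf_tmp => _ [m _ <-]; exact: lsc_submeasure_ge0.
Qed.

Lemma not_exh_idealP (A : set nat) : ~ exh_ideal phi A <->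
  exists2 r : R, (0 < r)%R & forall m, r%:E <= phi (A `\` `I_m).
Proof.
split=> [|[r r0 large] /exh_idealP/(_ _ r0)[m]].
  apply: contra_notP => nlarge; apply/exh_idealP => r r0.
  apply: contra_notP nlarge => nsmall; exists r => // m.
  by rewrite leNgt; apply/negP => phim; apply: nsmall; exists m.
by rewrite ltNge large.
Qed.

(** Otherwise all truncations of [A] have submeasure at most [s], and by lower semicontinuity so has
    [A]. *)
Lemma lsc_submeasure_finite_approx (A : set nat) (r s : R) :
  (s < r)%R -> r%:E <= phi A -> exists n, s%:E < phi (A `&` `I_n).
Proof.
move=> sr rA; apply: contrapT => small.
have : phi A <= s%:E.
  have <- := cvg_lim (@ereal_hausdorff R) (lsc_submeasure_cvg phi_lsc (A := A)).
  apply: lime_le; first by apply/cvg_ex; exists (phi A); exact: lsc_submeasure_cvg.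
  apply: nearW => n; rewrite leNgt; apply/negP => ?; apply: small.
  by exists n.
by move=> /(le_trans rA); rewrite lee_fin leNgt sr.
Qed.

(* Removing a set of [phi]-norm zero does not change the norm, so the tails of
   all the [A n] have submeasure bounded below by a single constant. *)
Lemma exh_ideal_uniform_lower_bound (A0 : set nat) (A : nat -> set nat) :
  ~ exh_ideal phi A0 -> (forall n, exh_ideal phi (A0 `\` A n)) ->
  exists2 r : R, (0 < r)%R & forall n m, r%:E <= phi (A n `\` `I_m).
Proof.
move=> /not_exh_idealP[r r0 large] small.
exists (r / 2)%R; first by rewrite divr_gt0.
move=> n m; rewrite leNgt; apply/negP => ltr.
have /exh_idealP/(_ (r / 2)%R) := small n.
case; first by rewrite divr_gt0.
move=> p ltr'.
(* Beyond both cutoffs, [A0] is covered by a tail of [A n] and a tail of the difference of [A0] and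
   [A n], each of submeasure below [r / 2]. *)
have := large (maxn m p); apply/negP; rewrite -ltNge.
have -> : r%:E = (r / 2)%:E + (r / 2)%:E by rewrite -EFinD -splitr.
apply: le_lt_trans (lteD ltr ltr').
apply: le_trans (lsc_submeasureU phi_lsc _ _).
apply: lsc_submeasure_le => // i [A0i /= /negP].
rewrite -leqNgt geq_max => /andP[mi pi].
have [Ai|nAi] := pselect (A n i); [left|right].
  by split=> //=; apply/negP; rewrite -leqNgt.
by split=> //=; apply/negP; rewrite -leqNgt.
Qed.

(* Each block [A k `&` [k, N k)] is finite with submeasure bounded below, so
   the union of the blocks is positive while almost contained in every [A n]. *)
Lemma exh_ideal_pseudo_intersection (A : nat -> set nat) (r : R) :
  (0 < r)%R -> (forall m n, (m <= n)%N -> A n `<=` A m) ->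
  (forall n m, r%:E <= phi (A n `\` `I_m)) ->
  exists2 B : set nat, ~ exh_ideal phi B & forall n, finite_set (B `\` A n).
Proof.
move=> r0 Adecr large.
have r20 : (0 < r / 2)%R by rewrite divr_gt0.
have r2r : (r / 2 < r)%R by rewrite ltr_pdivrMr// ltr_pMr// ltr1n.
have [N Nlarge] := choice (fun k =>
  lsc_submeasure_finite_approx r2r (large k k)).
exists (\bigcup_k ((A k `\` `I_k) `&` `I_(N k))).
  apply/not_exh_idealP; exists (r / 2)%R => // m.
  apply: le_trans (ltW (Nlarge m)) _; apply: lsc_submeasure_le => // i Ami.
  by split; [exists m | case: Ami => -[]].
(* By monotonicity, only the blocks with [k < n] can leave [A n]. *)
move=> n; apply: (@sub_finite_set _ _ (\bigcup_(k in `I_n) `I_(N k))).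
  move=> i [[k _ [[Aki _] Nki]] nAni]; exists k => //=.
  by rewrite ltnNge; apply/negP => nk; apply: nAni; exact: Adecr Aki.
by apply: bigcup_finite => *; exact: finite_II.
Qed.

End submeasure.

(** Greedy enumeration: each term is the least element of [B] above the previous one. *)
Lemma infinite_set_nat_enum (B : set nat) : infinite_set B ->
  exists2 nk : nat -> nat, increasing_seq nk & range nk = B.
Proof.
move=> Binf.
have ex m : exists n, (m <= n)%N && `[< B n >].
  apply: contrapT => none; apply: Binf.
  apply: (@sub_finite_set _ _ `I_m); last exact: finite_II.
  move=> n Bn /=; rewrite ltnNge; apply/negP => mn; apply: none.
  by exists n; rewrite mn; apply/asboolP.
pose next m := ex_minn (ex m).
have nextP m : [/\ (m <= next m)%N, B (next m) &
    forall n, B n -> (m <= n)%N -> (next m <= n)%N].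
  rewrite /next; case: ex_minnP => n /andP[mn /asboolP Bn] min; split=> // p Bp mp.
  by apply: min; rewrite mp; apply/asboolP.
pose fix nk k := if k is j.+1 then next (nk j).+1 else next 0%N.
have nk_inc k : (nk k < nk k.+1)%N by case: (nextP (nk k).+1).
have nk_ge k : (k <= nk k)%N.
  by elim: k => // k IH; exact: leq_ltn_trans IH (nk_inc k).
exists nk; first by apply/increasing_seqP; exact: nk_inc.
apply/seteqP; split=> [_ [k _ <-]|b Bb].
  case: k => [|k]; first by case: (nextP 0%N).
  by case: (nextP (nk k).+1).
(* For the least such [k], any preceding term is below [b], so the minimal choice of [nk k] forces
   [nk k <= b]. *)
have exk : exists k, (b <= nk k)%N by exists b.
case: (ex_minnP exk) => k bk min; exists k => //; apply/eqP.
rewrite eqn_leq bk andbT; case: k bk min => [|k] bk min /=.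
  by have [_ _] := nextP 0%N; exact.
have [_ _] := nextP (nk k).+1; apply=> //.
by rewrite ltnNge; apply/negP => /min; rewrite ltnn.
Qed.

(** Injectivity turns finitely many bad values of [nk] into finitely many bad indices [k]. *)
Lemma injective_cvg_cofinite (X : topologicalType) (x : nat -> X) (l : X)
    (nk : nat -> nat) : injective nk ->
  (forall U, nbhs l U -> finite_set (range nk `\` x @^-1` U)) ->
  x (nk k) @[k --> \oo] --> l.
Proof.
move=> nk_inj fin U /fin finU.
have /finite_seqP[s s_eq] : finite_set (nk @^-1` (range nk `\` x @^-1` U)).
  by apply: finite_preimage => // i j _ _; exact: nk_inj.
exists (\max_(i <- s) i).+1%N => // k /= sk; apply: contrapT => nUk.
suff ks : k \in s.
  by have := @leq_bigmax_seq nat s xpredT id k ks isT; rewrite leqNgt sk.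
suff : [set` s] k by [].
by rewrite -s_eq; split => //; exists k.
Qed.

Lemma first_countable_decreasing_base (X : topologicalType) (l : X) :
  first_countable X -> exists U : nat -> set X,
  [/\ forall n, nbhs l (U n), forall m n, (m <= n)%N -> U n `<=` U m &
      forall V, nbhs l V -> exists n, U n `<=` V].
Proof.
move=> /(_ l)[B [Bcnt Bnbhs Bbase]].
(* Either [B] is empty, impossible since [setT] is a neighborhood of [l], or [f] enumerates it;
   finite intersections of the [f k] then decrease. *)
have [B0|[f]] := pfcard_geP Bcnt.
  by have [V] := Bbase setT filterT; rewrite B0.
have fB n : B (f n) by exact: funS.
exists (fun n => \bigcap_(k in `I_n.+1) f k); split=> [n|m n mn y Uny k km|V].
- by rewrite bigcap_mkord; apply: (@big_ind _ (nbhs l)) => [|S T|k _];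
    [exact: filterT | exact: filterI | exact: Bnbhs].
- by apply: Uny; exact: leq_trans mn.
move=> /Bbase[W BW WV]; have [n _ fnW] := surj (f := f) BW.
by exists n => y Uny; apply: WV; rewrite -fnW; apply: Uny => /=.
Qed.

(* If the preimage of [C] were not in [I], the sets [S] with
   [x @^-1` (C `\` S)] in [I] would form a proper filter containing [C], and
   any cluster point of this filter would be an [I]-cluster point of [x]. *)
Lemma compact_no_cluster_ideal (X : topologicalType) (x : nat -> X)
    (I : set (set nat)) (C : set X) :
  ideal I -> compact C -> C `&` ideal_cluster_points x I = set0 ->
  I (x @^-1` C).
Proof.
move=> idI cC C0; apply: contrapT => nIC.
pose F : set_system X := [set S | I (x @^-1` (C `\` S))].
have FF : ProperFilter F.
  split; first by rewrite /F /= setD0.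
  split.
  - by rewrite /F /= setDT preimage_set0; apply: ideal_finite idI _ _.
  - move=> S T FS FT; rewrite /F /= setDIr preimage_setU; exact: ideal_setU.
  - by move=> S T ST; apply: (ideal_sub idI) => i [Ci nTi]; split=> // /ST.
have FC : F C by rewrite /F /= setDv preimage_set0; apply: ideal_finite idI _ _.
have [p [Cp pcl]] := cC F FF FC.
suff : (C `&` ideal_cluster_points x I) p by rewrite C0.
split=> // U pU IU.
have FnU : F (~` U).
  by apply: (ideal_sub idI) IU => i [_ /=]; rewrite notK.
by have [y []] := pcl _ _ FnU pU.
Qed.

Theorem theorem2p7 (R : realType) (X : topologicalType)
  (X_locally_compact : locally_compact [set: X]%classic)
  (X_first_countable : first_countable X)
  (X_hausdorff : hausdorff_space X)
  (x : nat -> X) (phi : set nat -> \bar R)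
  (phi_analytic : analytic_Pideal_of phi) (l : X)
  (l_isolated : isolated (ideal_cluster_points x (exh_ideal phi)) l) :
  ideal_limit_points x (exh_ideal phi) l.
Proof.
have [phi_lsc _ idI] := phi_analytic.
have [/set_mem l_cluster [V lV V_l]] := l_isolated.
have [K0] := X_locally_compact l I; rewrite withinET => lK0 [K0c K0cl].
(* Regularity at [l] shrinks [K0] to a compact neighborhood [K] contained in [V]. *)
have [W lW WV] := compact_regular X_hausdorff K0c lK0 lV.
pose K := K0 `&` closure W.
have lK : nbhs l K by apply: filterI => //; exact: filterS (@subset_closure _ W) lW.
have Kc : compact K by apply: compact_closedI => //; exact: closed_closure.
have [U [lU Udecr Ubase]] := first_countable_decreasing_base l X_first_countable.
have small n : exh_ideal phi (x @^-1` K `\` x @^-1` (U n)).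
  (* [U n] need not be open; removing only its interior from [K] leaves a compact set. *)
  apply: (ideal_sub idI (B := x @^-1` (K `&` ~` (U n)°))).
    by move=> i [Ki nUi]; split=> // /interior_subset.
  apply: compact_no_cluster_ideal => //.
    by apply: compact_closedI => //; apply: open_closedC; exact: open_interior.
  (* A cluster point in this set would lie in [V], hence equal [l], which is interior to [U n]. *)
  rewrite -subset0 => p [[[_ /WV Vp] nUp] p_cluster].
  have : (V `&` ideal_cluster_points x (exh_ideal phi)) p by [].
  by rewrite V_l => pl; apply: nUp; rewrite pl; exact: nbhs_singleton (nbhs_interior _).
have [r r0 large] :=
  exh_ideal_uniform_lower_bound phi_lsc (l_cluster _ lK) small.
have [|B nIB Bfin] := exh_ideal_pseudo_intersection phi_lsc r0 _ large.
  by move=> m n mn i; exact: Udecr.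
have [|nk nk_incr nkB] := @infinite_set_nat_enum B.
  by move=> /(ideal_finite idI).
exists nk; split=> //; last by rewrite nkB.
apply: injective_cvg_cofinite; first exact: increasing_seq_injective.
move=> S /Ubase[n UnS]; rewrite nkB; apply: sub_finite_set (Bfin n).
by move=> i [Bi nSi]; split=> // /UnS.
Qed.
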